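(* The following three identities hold: $$\zeta(3)=\frac{4\pi^2}{35}\left(\frac{3}{2}-\log\left(\frac{\pi}{2}\right)+\sum_{n=1}^{\infty}\frac{\zeta(2n)}{n(n+1)(2n+1)16^n}\right),$$ $$\zeta(3)=-\frac{64}{3\pi}\beta(4)+\frac{8\pi^2}{9}\left(\frac{4}{3}-\log\left(\frac{\pi}{2}\right)+3\sum_{n=1}^{\infty}\frac{\zeta(2n)}{n(2n+1)(2n+3)16^n}\right),$$ and $$\zeta(3)=-\frac{64}{3\pi}\beta(4)+\frac{16\pi^2}{27}\left(\frac{1}{2}+\frac{3G}{\pi}-3\sum_{n=1}^{\infty}\frac{\zeta(2n)}{(2n+1)(2n+3)16^n}\right),$$ where $G$ is Catalan's constant and $\beta$ is the Dirichlet beta function.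
   Context: $\zeta(s)=\sum_{n=1}^\infty n^{-s}$ (for $\operatorname{Re}(s)>1$) is the Riemann zeta function. The Dirichlet beta function is $\beta(s)=\sum_{n=0}^{\infty}\frac{(-1)^n}{(2n+1)^s}$, and Catalan's constant is $G=\beta(2)=\sum_{n=0}^{\infty}\frac{(-1)^n}{(2n+1)^2}$. $\log$ is the natural logarithm. *)

(* Defs.v *)
From Stdlib Require Import Reals.
From Coquelicot Require Import Coquelicot.
Open Scope R_scope.

(* The Dirichlet series of the Riemann zeta function at a real argument;
   meaningful for 1 < s.  The index k stands for n = k + 1. *)
Definition zeta (s : R) : R :=
  Series (fun k : nat => / Rpower (INR (k + 1)) s).

(* Meaningful for 0 < s. *)
Definition dirichlet_beta (s : R) : R :=
  Series (fun n : nat => (-1) ^ n / Rpower (INR (2 * n + 1)) s).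

Definition Catalan : R := dirichlet_beta 2.

(* The sum over n >= 1 of a n converges, with value l. *)
Definition is_series_from1 (a : nat -> R) (l : R) : Prop :=
  is_series (fun k : nat => a (k + 1)%nat) l.

(* Main.v *)
Require Import Defs.
From Stdlib Require Import Reals Lra Lia.
From Coquelicot Require Import Coquelicot.
Open Scope R_scope.

(** The three sums are linear combinations, by partial fractions in n, of
    - A = sum of zeta(2n) / (n 16^n), and
    - Z_m = sum of zeta(2n) / ((2n + m + 1) 16^n) for m = 0, 1, 2:
    1 / (n (n+1) (2n+1)) = 1/n + 2/(2n+2) - 4/(2n+1), and so on.  All four are
    read off from the expansion
      (t/2) cot(t/2) = 1 - 2 sum of zeta(2n) (t / 2pi)^(2n)
    at t <= pi/2, where t / 2pi <= 1/4 produces the powers of 16.  Dividing by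
    t and integrating gives A as a logarithm ([zeta_log_series]); multiplying
    by t^m and integrating over [0, pi/2] gives Z_m in terms of the moment
      M_m = integral over [0, pi/2] of t^m (t/2) cot(t/2) dt
    ([zeta_moment_series]).

    The expansion itself is the partial fraction series of the cotangent
    ([cot_partial_fractions]) with every fraction expanded geometrically; all
    terms being positive, the remainder is explicitly bounded
    ([zeta_expansion_remainder]) and no exchange of infinite sums occurs.

    The moments are evaluated a second time through the formal identity
    (1/2) cot(t/2) = sum of sin(nt).  Its partial sums differ from the left
    side by cos((N + 1/2) t) / (2 sin(t/2)); after multiplication by t^(m+1)
    the singularity at 0 disappears and the difference integrates to something
    that tends to 0, so M_m = sum over n of the integral of t^(m+1) sin(nt)
    ([cot_moment_sine_series]).  These integrals are elementary, and at the end
    point pi/2 the values of sin(nt) and cos(nt) are 0, 1 or -1 with period 4.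
    Hence M_0, M_1, M_2 are combinations of log 2, G, zeta(3) and beta(4)
    ([cot_moment_0], [cot_moment_1], [cot_moment_2]), and in each of the three
    sums the terms in log 2 cancel.

    The partial fraction series is obtained by the same device: it is the
    Fourier series of cos(x (pi - u)) at u = 0.  A single estimate, the decay
    of oscillatory integrals of a C^1 function
    ([oscillatory_integral_bound]), carries both. *)

(** * Sums, series and integrals of real functions *)

(** The next lemmas restate general facts at the real numbers, so that [ring],
    [field] and [rewrite] meet the operations of R and not those of an abstract
    module. *)
Lemma sum_n_mul_l (c : R) (u : nat -> R) (N : nat) :
  sum_n (fun k => c * u k) N = c * sum_n u N.
Proof. exact (sum_n_mult_l (K := R_Ring) c u N). Qed.

Lemma sum_n_ext_R (u v : nat -> R) (N : nat) :
  (forall k, u k = v k) -> sum_n u N = sum_n v N.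
Proof. exact (sum_n_ext u v N). Qed.

Lemma sum_Sn_R (u : nat -> R) (N : nat) :
  sum_n u (S N) = sum_n u N + u (S N).
Proof. exact (sum_Sn u N). Qed.

Lemma is_series_scal_R (c : R) (u : nat -> R) (l : R) :
  is_series u l -> is_series (fun k => c * u k) (c * l).
Proof. exact (is_series_scal_l c u l). Qed.

Lemma is_series_plus_R (u v : nat -> R) (l m : R) :
  is_series u l -> is_series v m -> is_series (fun k => u k + v k) (l + m).
Proof. exact (is_series_plus u v l m). Qed.

Lemma is_series_ext_R (u v : nat -> R) (l : R) :
  (forall k, u k = v k) -> is_series u l -> is_series v l.
Proof. exact (is_series_ext u v l). Qed.

Lemma is_series_le_R (u v : nat -> R) (l m : R) :
  (forall n, u n <= v n) -> is_series u l -> is_series v m -> l <= m.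
Proof.
  intros Huv Hu Hv.
  apply (is_lim_seq_le (sum_n u) (sum_n v) l m); try assumption.
  intros N. rewrite !sum_n_Reals. apply sum_Rle. intros n _; apply Huv.
Qed.

Lemma is_series_eq (u v : nat -> R) (l m : R) :
  is_series u l -> is_series v m -> (forall j, u j = v j) -> l = m.
Proof.
  intros Hu Hv H. apply is_series_unique in Hu. apply is_series_unique in Hv.
  rewrite <- Hu, <- Hv. apply Series_ext, H.
Qed.

Lemma is_series_sum_n (u : nat -> nat -> R) (l : nat -> R) (N : nat) :
  (forall n, is_series (u n) (l n)) ->
  is_series (fun k => sum_n (fun n => u n k) N) (sum_n l N).
Proof.
  intros H. induction N as [|N IH].
  - rewrite sum_O. eapply is_series_ext_R; [|apply H].
    intros k; simpl. rewrite sum_O. reflexivity.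
  - rewrite sum_Sn_R. eapply is_series_ext_R; [|apply (is_series_plus_R _ _ _ _ IH (H (S N)))].
    intros k; simpl. rewrite sum_Sn_R. reflexivity.
Qed.

(** The partial sums of the paired series are a subsequence of the original
    ones. *)
Lemma is_series_pairs (u : nat -> R) (l : R) :
  is_series u l -> is_series (fun j => u (2 * j)%nat + u (2 * j + 1)%nat) l.
Proof.
  intros Hu.
  change (is_lim_seq (sum_n (fun j => u (2 * j)%nat + u (2 * j + 1)%nat)) l).
  apply is_lim_seq_ext with (fun N => sum_n u (2 * N + 1)).
  - intros N. induction N as [|N IH].
    + simpl. rewrite sum_Sn_R, !sum_O. reflexivity.
    + rewrite (sum_Sn_R _ N), <- IH.
      replace (2 * S N + 1)%nat with (S (S (2 * N + 1))) by lia.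
      rewrite !sum_Sn_R.
      replace (S (2 * N + 1)) with (2 * S N)%nat by lia. ring.
  - apply (is_lim_seq_subseq (sum_n u) l (fun N => (2 * N + 1)%nat)); [|exact Hu].
    apply eventually_subseq. intros n. lia.
Qed.

(** The zeta series below have positive terms that decay like 16^-n, so their
    remainders are bounded in this form. *)
Lemma is_series_from1_squeeze (u : nat -> R) (l C q : R) :
  Rabs q < 1 ->
  (forall N, 0 <= l - sum_n (fun n => u (n + 1)%nat) N <= C * q ^ N) ->
  is_series_from1 u l.
Proof.
  intros Hq H.
  change (is_lim_seq (sum_n (fun n => u (n + 1)%nat)) l).
  apply is_lim_seq_le_le with (u := fun N => l - C * q ^ N) (w := fun _ => l).
  - intros N. specialize (H N). lra.
  - replace (Finite l) with (Finite (l - C * 0)) by (f_equal; ring).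
    apply is_lim_seq_minus'; [apply is_lim_seq_const|].
    apply (is_lim_seq_scal_l _ C (Finite 0)), is_lim_seq_geom, Hq.
  - apply is_lim_seq_const.
Qed.

Lemma is_series_from1_combination (u v w s : nat -> R) (lu lv lw a b c : R) :
  is_series_from1 u lu -> is_series_from1 v lv -> is_series_from1 w lw ->
  (forall n, (1 <= n)%nat -> s n = a * u n + (b * v n + c * w n)) ->
  is_series_from1 s (a * lu + (b * lv + c * lw)).
Proof.
  intros Hu Hv Hw Hs. unfold is_series_from1.
  eapply is_series_ext_R; [|apply is_series_plus_R; [apply is_series_scal_R, Hu|
    apply is_series_plus_R; apply is_series_scal_R; [exact Hv | exact Hw]]].
  intros k. symmetry. apply Hs. lia.
Qed.

Lemma is_RInt_scal_R (f : R -> R) (a b c l : R) :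
  is_RInt f a b l -> is_RInt (fun t => c * f t) a b (c * l).
Proof. exact (is_RInt_scal f a b c l). Qed.

Lemma is_RInt_plus_R (f g : R -> R) (a b l m : R) :
  is_RInt f a b l -> is_RInt g a b m -> is_RInt (fun t => f t + g t) a b (l + m).
Proof. exact (is_RInt_plus f g a b l m). Qed.

Lemma is_RInt_minus_R (f g : R -> R) (a b l m : R) :
  is_RInt f a b l -> is_RInt g a b m -> is_RInt (fun t => f t - g t) a b (l - m).
Proof. exact (is_RInt_minus f g a b l m). Qed.

Lemma is_RInt_eq (f g : R -> R) (a b l m : R) :
  (forall t, f t = g t) -> l = m -> is_RInt f a b l -> is_RInt g a b m.
Proof. intros Hfg <-. apply is_RInt_ext. intros t _; apply Hfg. Qed.

Lemma is_RInt_ext_R (f g : R -> R) (a b l : R) : a <= b ->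
  (forall t, a < t < b -> f t = g t) -> is_RInt f a b l -> is_RInt g a b l.
Proof.
  intros Hab H. apply is_RInt_ext.
  rewrite Rmin_left, Rmax_right by exact Hab. exact H.
Qed.

Lemma is_RInt_antiderivative (F f : R -> R) (a b : R) :
  (forall t, is_derive F t (f t)) -> (forall t, ex_derive f t) ->
  is_RInt f a b (F b - F a).
Proof.
  intros HF Hf. apply (is_RInt_derive (V := R_CompleteNormedModule) F).
  - intros t _; apply HF.
  - intros t _; apply (ex_derive_continuous f), Hf.
Qed.

Lemma is_RInt_sum_n (f : nat -> R -> R) (I : nat -> R) (a b : R) (N : nat) :
  (forall n, is_RInt (f n) a b (I n)) ->
  is_RInt (fun t => sum_n (fun n => f n t) N) a b (sum_n I N).
Proof.
  intros H. induction N as [|N IH].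
  - rewrite sum_O. eapply is_RInt_ext; [|apply (H 0%nat)].
    intros t _; simpl. rewrite sum_O. reflexivity.
  - rewrite sum_Sn. eapply is_RInt_ext; [|apply (is_RInt_plus _ _ _ _ _ _ IH (H (S N)))].
    intros t _; simpl. rewrite sum_Sn. reflexivity.
Qed.

Lemma INR_plus_1_ge_1 (k : nat) : 1 <= INR k + 1.
Proof. pose proof (pos_INR k). lra. Qed.

Lemma is_RInt_monomial (p : nat) (a : R) :
  is_RInt (fun t => t ^ p) 0 a (a ^ (p + 1) / (INR p + 1)).
Proof.
  pose proof (INR_plus_1_ge_1 p) as Hp.
  eapply is_RInt_eq; [reflexivity| |apply (is_RInt_pow 0 a p)].
  rewrite Nat.add_1_r, S_INR, (pow_i (S p)) by lia. field. lra.
Qed.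

(** * The function sin t / t *)

(** The sine series divided by its variable; [sin_n] holds the coefficients
    of sin t / t in powers of t^2.  As a power series it is smooth at 0, which
    makes the quotients by sin(t/2) below C^1 up to the end point 0. *)
Definition sinc (t : R) : R := PSeries sin_n (t ^ 2).

Lemma mul_sinc (t : R) : t * sinc t = sin t.
Proof.
  unfold sin, sinc.
  destruct (exist_sin (Rsqr t)) as [l Hl].
  f_equal. apply is_series_unique, is_series_Reals.
  replace (t ^ 2) with (Rsqr t) by (unfold Rsqr; ring).
  exact Hl.
Qed.

Lemma CV_radius_sin_n : CV_radius sin_n = p_infty.
Proof.
  apply CV_radius_infinite_DAlembert; [exact sin_no_R0|].
  apply is_lim_seq_Reals. intros eps Heps.
  destruct (Alembert_sin eps Heps) as [N HN].
  exists N. intros n Hn. specialize (HN n Hn).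
  unfold Rdist in *. rewrite Rminus_0_r, Rabs_Rabsolu in *. exact HN.
Qed.

(** The derivative of [sinc], as an explicit power series so that its own
    differentiability is available. *)
Definition dsinc (t : R) : R := PSeries (PS_derive sin_n) (t ^ 2) * (2 * t).

Lemma is_derive_sinc (t : R) : is_derive sinc t (dsinc t).
Proof.
  unfold sinc, dsinc.
  evar_last.
  { apply (is_derive_comp (PSeries sin_n) (fun t => t ^ 2)).
    - apply is_derive_PSeries. rewrite CV_radius_sin_n. exact I.
    - auto_derive; [exact I | reflexivity]. }
  cbv [scal mult]; simpl. cbv [mult]; simpl. ring.
Qed.

Lemma ex_derive_sinc (t : R) : ex_derive sinc t.
Proof. eexists; apply is_derive_sinc. Qed.

Lemma ex_derive_dsinc (t : R) : ex_derive dsinc t.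
Proof.
  unfold dsinc. apply (ex_derive_mult (fun t => PSeries (PS_derive sin_n) (t ^ 2))).
  - apply (ex_derive_comp (PSeries (PS_derive sin_n)) (fun t => t ^ 2)).
    + eexists. apply is_derive_PSeries.
      rewrite CV_radius_derive, CV_radius_sin_n. exact I.
    + auto_derive. exact I.
  - auto_derive. exact I.
Qed.

Lemma Derive_sinc (t : R) : Derive (fun x => sinc x) t = dsinc t.
Proof. apply is_derive_unique, is_derive_sinc. Qed.

Lemma sinc_0 : sinc 0 = 1.
Proof.
  unfold sinc. replace (0 ^ 2) with 0 by ring.
  rewrite PSeries_0. unfold sin_n. simpl. field.
Qed.

Lemma sinc_pos (t : R) : 0 <= t < PI -> 0 < sinc t.
Proof.
  intros [[H0|<-] H1].
  - apply Rmult_lt_reg_l with t; [lra|].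
    rewrite mul_sinc, Rmult_0_r. apply sin_gt_0; lra.
  - rewrite sinc_0; lra.
Qed.

Lemma sinc_neq_0 (t : R) : 0 <= t < PI -> sinc t <> 0.
Proof. intros H. pose proof (sinc_pos t H). lra. Qed.

(** Differentiate t sinc t = sin t. *)
Lemma sinc_add_mul_dsinc (y : R) : sinc y + y * dsinc y = cos y.
Proof.
  assert (H1 : is_derive (fun y => y * sinc y) y (sinc y + y * dsinc y)).
  { auto_derive; [apply ex_derive_sinc|]. rewrite Derive_sinc. ring. }
  apply is_derive_unique in H1. rewrite <- H1.
  rewrite (Derive_ext _ sin) by apply mul_sinc.
  apply is_derive_unique, is_derive_sin.
Qed.

(** This is y cot y, extended by 1 at y = 0. *)
Definition xcot (y : R) : R := cos y / sinc y.

Lemma ex_derive_xcot (y : R) : 0 <= y < PI -> ex_derive xcot y.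
Proof.
  intros Hy. unfold xcot. pose proof (sinc_neq_0 y Hy).
  auto_derive. repeat split; auto using ex_derive_sinc.
Qed.

(** * Oscillatory integrals and Dirichlet kernels *)

(** One integration by parts: a primitive of the oscillating factor has size
    1 / lambda, and the boundary terms and the integral of |f'| are
    independent of lambda and phi. *)
Lemma oscillatory_integral_bound (f f' : R -> R) (a b : R) :
  a <= b ->
  (forall t, a <= t <= b -> is_derive f t (f' t)) ->
  (forall t, a <= t <= b -> continuous f' t) ->
  exists C, forall lambda phi, 0 < lambda ->
    Rabs (RInt (fun t => f t * sin (lambda * t + phi)) a b) <= C / lambda.
Proof.
  intros Hab Hf Hf'.
  exists (Rabs (f a) + Rabs (f b) + RInt (fun t => Rabs (f' t)) a b).
  intros la phi Hla.
  set (g := fun t => - cos (la * t + phi) / la).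
  assert (Hmm : forall t, Rmin a b <= t <= Rmax a b -> a <= t <= b)
    by (intros t; rewrite Rmin_left, Rmax_right by lra; tauto).
  assert (Hg : forall t, Rabs (g t) <= / la).
  { intros t. unfold g, Rdiv. rewrite Rabs_mult, Rabs_Ropp.
    rewrite (Rabs_pos_eq (/ la)) by (apply Rlt_le, Rinv_0_lt_compat; lra).
    rewrite <- (Rmult_1_l (/ la)) at 2.
    apply Rmult_le_compat_r; [apply Rlt_le, Rinv_0_lt_compat; lra|].
    apply Rabs_le. apply COS_bound. }
  assert (Hgd : forall t, is_derive g t (sin (la * t + phi))).
  { intros t. unfold g. auto_derive; [exact I|]. field. lra. }
  assert (Hcg : forall t, continuous g t)
    by (intros t; apply (ex_derive_continuous g); eexists; apply Hgd).
  assert (Hex : ex_RInt (fun t => f' t * g t) a b).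
  { apply (ex_RInt_continuous (V := R_CompleteNormedModule)). intros t Ht.
    apply (continuous_mult f' g); [apply Hf', Hmm, Ht | apply Hcg]. }
  assert (Habs : ex_RInt (fun t => Rabs (f' t)) a b).
  { apply (ex_RInt_continuous (V := R_CompleteNormedModule)). intros t Ht.
    apply continuous_comp; [apply Hf', Hmm, Ht | apply continuous_Rabs]. }
  assert (HI : is_RInt (fun t => f t * sin (la * t + phi)) a b
     (f b * g b - f a * g a - RInt (fun t => f' t * g t) a b)).
  { apply (is_RInt_scal_derive_r (V := R_CompleteNormedModule) f g f'
             (fun t => sin (la * t + phi))).
    - intros t Ht; apply Hf, Hmm, Ht.
    - intros t _; apply Hgd.
    - intros t Ht; apply Hf', Hmm, Ht.
    - intros t _. apply (ex_derive_continuous (fun t => sin (la * t + phi))).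
      auto_derive. exact I.
    - apply (RInt_correct (V := R_CompleteNormedModule)), Hex. }
  rewrite (is_RInt_unique _ _ _ _ HI).
  assert (H3 : Rabs (RInt (fun t => f' t * g t) a b)
               <= RInt (fun t => Rabs (f' t)) a b * / la).
  { eapply Rle_trans; [apply abs_RInt_le; assumption|].
    rewrite (Rmult_comm (RInt _ a b)).
    rewrite <- (RInt_scal (V := R_CompleteNormedModule)) by exact Habs.
    apply RInt_le; [assumption| | |].
    - apply (ex_RInt_continuous (V := R_CompleteNormedModule)). intros t Ht.
      apply (continuous_comp (fun t => f' t * g t)); [|apply continuous_Rabs].
      apply (continuous_mult f' g); [apply Hf', Hmm, Ht | apply Hcg].
    - apply (ex_RInt_scal (V := R_CompleteNormedModule)), Habs.
    - intros t _. rewrite Rabs_mult. cbv [scal mult]; simpl; cbv [mult]; simpl.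
      rewrite Rmult_comm.
      apply Rmult_le_compat_r; [apply Rabs_pos | apply Hg]. }
  assert (H1 : forall t, Rabs (f t * g t) <= Rabs (f t) * / la).
  { intros t. rewrite Rabs_mult. apply Rmult_le_compat_l; [apply Rabs_pos | apply Hg]. }
  unfold Rdiv. rewrite !Rmult_plus_distr_r.
  pose proof (H1 a); pose proof (H1 b).
  unfold Rminus.
  eapply Rle_trans; [apply Rabs_triang|].
  eapply Rle_trans; [apply Rplus_le_compat_r, Rabs_triang|].
  rewrite !Rabs_Ropp. lra.
Qed.

(** The frequencies are those of the two Dirichlet kernels below: c = 1 when
    the terms of the trigonometric sum enter one by one, c = 2 when they enter
    in pairs. *)
Lemma oscillatory_integral_lim (f f' : R -> R) (a b c phi : R) :
  a <= b -> 0 < c ->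
  (forall t, a <= t <= b -> is_derive f t (f' t)) ->
  (forall t, a <= t <= b -> continuous f' t) ->
  is_lim_seq
    (fun N => RInt (fun t => f t * sin ((c * (INR N + 1)+ / 2) * t + phi)) a b) 0.
Proof.
  intros Hab Hc Hf Hf'.
  destruct (oscillatory_integral_bound f f' a b Hab Hf Hf') as [C HC].
  assert (HC0 : 0 <= C).
  { specialize (HC 1 0 Rlt_0_1). pose proof (Rabs_pos (RInt (fun t => f t * sin (1 * t + 0)) a b)). lra. }
  apply is_lim_seq_abs_0.
  apply is_lim_seq_le_le with (u := fun _ => 0) (w := fun N => C / c * / (INR N + 1)).
  - intros N. split; [apply Rabs_pos|].
    pose proof (pos_INR N).
    eapply Rle_trans; [apply HC; nra|].
    replace (C / c * / (INR N + 1)) with (C / (c * (INR N + 1))) by (field; lra).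
    unfold Rdiv. apply Rmult_le_compat_l; [assumption|].
    apply Rinv_le_contravar; nra.
  - apply is_lim_seq_const.
  - replace (Finite 0) with (Rbar_mult (C / c) 0) by (simpl; f_equal; ring).
    apply is_lim_seq_scal_l.
    apply is_lim_seq_ext with (fun n => / INR (S n)); [intros n; rewrite S_INR; reflexivity|].
    apply (is_lim_seq_incr_1 (fun n => / INR n)).
    replace (Finite 0) with (Rbar_inv p_infty) by reflexivity.
    apply is_lim_seq_inv; [apply is_lim_seq_INR | discriminate].
Qed.

(** The product 2 sin(u/2) cos(nu) = sin((n + 1/2) u) - sin((n - 1/2) u)
    telescopes. *)
Lemma Dirichlet_kernel_cos (u : R) (N : nat) :
  (/ 2 + sum_n (fun k => cos ((INR k + 1) * u)) N) * (2 * sin (u / 2))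
  = sin ((INR N + 1 + / 2) * u).
Proof.
  induction N as [|N IH].
  - rewrite sum_O. simpl INR.
    replace ((0 + 1) * u) with (u / 2 + u / 2) by field.
    replace ((0 + 1 + / 2) * u) with (u / 2 + u / 2 + u / 2) by field.
    rewrite !sin_plus, !cos_plus.
    pose proof (sin2_cos2 (u / 2)) as H. unfold Rsqr in H.
    set (s := sin (u / 2)) in *. set (c := cos (u / 2)) in *.
    assert (Hc : c * c = 1 - s * s) by lra.
    replace ((/ 2 + (c * c - s * s)) * (2 * s)) with (s + 2 * s * (c * c) - 2 * s * s * s) by field.
    replace ((s * c + c * s) * c + (c * c - s * s) * s) with (3 * s * (c * c) - s * s * s) by ring.
    rewrite Hc. ring.
  - rewrite sum_Sn_R, <- Rplus_assoc, Rmult_plus_distr_r, IH.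
    rewrite S_INR.
    replace ((INR N + 1 + / 2) * u) with ((INR N + 1 + 1) * u - u / 2) by field.
    replace ((INR N + 1 + 1 + / 2) * u) with ((INR N + 1 + 1) * u + u / 2) by field.
    rewrite sin_plus, sin_minus. ring.
Qed.

(** Here 2 sin(u/2) sin(nu) = cos((n - 1/2) u) - cos((n + 1/2) u) telescopes.
    The terms n = 2j+1 and n = 2j+2 are taken together because at u = pi/2 one
    of sin(nu), cos(nu) vanishes according to the parity of n. *)
Lemma Dirichlet_kernel_sin (u : R) (N : nat) :
  sum_n (fun j => sin ((2 * INR j + 1) * u) + sin ((2 * INR j + 2) * u)) N
    * (2 * sin (u / 2))
  = cos (u / 2) - cos ((2 * (INR N + 1) + / 2) * u).
Proof.
  assert (H : forall v, (sin v + sin (v + u)) * (2 * sin (u / 2))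
              = cos (v - u / 2) - cos (v + u + u / 2)).
  { intros v.
    replace (v + u) with (v + u / 2 + u / 2) by field.
    replace v with (v + u / 2 - u / 2) at 1 3 by field.
    set (w := v + u / 2).
    rewrite sin_minus, sin_plus.
    replace (w - u / 2 - u / 2) with (w - (u / 2 + u / 2)) by ring.
    replace (w + u / 2 + u / 2) with (w + (u / 2 + u / 2)) by ring.
    rewrite cos_minus, !cos_plus, sin_plus. ring. }
  induction N as [|N IH].
  - rewrite sum_O. simpl INR.
    replace ((2 * 0 + 2) * u) with ((2 * 0 + 1) * u + u) by ring.
    rewrite H.
    replace ((2 * 0 + 1) * u - u / 2) with (u / 2) by field.
    replace ((2 * 0 + 1) * u + u + u / 2) with ((2 * (0 + 1) + / 2) * u) by field.
    reflexivity.
  - rewrite sum_Sn_R, Rmult_plus_distr_r, IH, S_INR.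
    replace ((2 * (INR N + 1) + 2) * u) with ((2 * (INR N + 1) + 1) * u + u) by ring.
    rewrite H.
    replace ((2 * (INR N + 1) + 1) * u - u / 2) with ((2 * (INR N + 1) + / 2) * u) by field.
    replace ((2 * (INR N + 1) + 1) * u + u + u / 2) with ((2 * (INR N + 1 + 1) + / 2) * u) by field.
    ring.
Qed.

(** * Partial fractions of the cotangent *)

Lemma sin_INR_PI (n : nat) : sin (INR n * PI) = 0.
Proof. apply sin_eq_0_1. exists (Z.of_nat n). rewrite INR_IZR_INZ. reflexivity. Qed.

(** The Fourier coefficients of u |-> cos(x (pi - u)) - cos(pi x). *)
Lemma is_RInt_cos_kernel_term (x : R) (k : nat) : 0 < x < 1 ->
  is_RInt (fun u => (cos (x * (PI - u)) - cos (PI * x)) * cos ((INR k + 1) * u)) 0 PI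
    (- (sin (PI * x) / x) * (x ^ 2 / ((INR k + 1) ^ 2 - x ^ 2))).
Proof.
  intros Hx. pose proof (pos_INR k) as Hk. pose proof PI_RGT_0 as Hpi.
  (* the primitive after the product formula for the two cosines *)
  set (F := fun u => sin (x * (PI - u) + (INR k + 1) * u) / (2 * (INR k + 1 - x))
             - sin (x * (PI - u) - (INR k + 1) * u) / (2 * (INR k + 1 + x))
             - cos (PI * x) * sin ((INR k + 1) * u) / (INR k + 1)).
  evar_last.
  { apply (is_RInt_derive (V := R_CompleteNormedModule) F).
    - intros u _. unfold F. auto_derive; [exact I|].
      change (PI + - u) with (PI - u).
      change (x * (PI - u) + - ((INR k + 1) * u)) with (x * (PI - u) - (INR k + 1) * u).
      rewrite cos_plus, cos_minus. field. lra.
    - intros u _.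
      apply (ex_derive_continuous (fun u => (cos (x * (PI - u)) - cos (PI * x)) * cos ((INR k + 1) * u))).
      auto_derive. exact I. }
  unfold F. cbv [minus plus opp]; simpl.
  replace (PI + - PI) with 0 by ring.
  unfold Rminus.
  rewrite !Ropp_0, !Rplus_0_r, !Rmult_0_r, !Rplus_opp_r, ?Rmult_0_r, ?Rplus_0_l, ?Ropp_0, ?Rplus_0_r.
  rewrite sin_neg.
  replace ((INR k + 1) * PI) with (INR (S k) * PI) by (rewrite S_INR; reflexivity).
  rewrite sin_INR_PI, sin_0. rewrite (Rmult_comm x PI).
  field. repeat split; nra.
Qed.

(** The function q(u) = cos(x (pi - u)) - cos(pi x) vanishes at 0, so q is the
    product of 2 sin(u/2) and a C^1 function h.  The integral of q against the
    Dirichlet kernel is thus an oscillatory integral of h and tends to 0, while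
    term by term it is a partial sum of the series. *)
Lemma cot_partial_fractions (x : R) : 0 < x < 1 ->
  is_series (fun k => x ^ 2 / ((INR k + 1) ^ 2 - x ^ 2)) ((1 - xcot (PI * x)) / 2).
Proof.
  intros Hx. pose proof PI_RGT_0 as Hpi.
  assert (Hs : 0 < sin (PI * x)) by (apply sin_gt_0; nra).
  set (q := fun u => cos (x * (PI - u)) - cos (PI * x)).
  set (h := fun u => x * sin (x * (PI - u / 2)) * sinc (x * u / 2) / sinc (u / 2)).
  assert (Hsinc : forall u, 0 <= u <= PI -> sinc (u / 2) <> 0)
    by (intros u Hu; apply sinc_neq_0; lra).
  assert (Hq : forall u, 0 <= u <= PI -> q u = h u * (2 * sin (u / 2))).
  { intros u Hu. unfold q, h.
    replace (x * (PI - u)) with (x * (PI - u / 2) - x * u / 2) by field.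
    replace (PI * x) with (x * (PI - u / 2) + x * u / 2) by field.
    rewrite cos_plus, cos_minus, <- (mul_sinc (u / 2)), <- (mul_sinc (x * u / 2)).
    field. apply Hsinc, Hu. }
  assert (HI : forall N, is_RInt (fun u => q u * (/ 2 + sum_n (fun k => cos ((INR k + 1) * u)) N)) 0 PI
      (sin (PI * x) / (2 * x) - PI * cos (PI * x) / 2
       - sin (PI * x) / x * sum_n (fun k => x ^ 2 / ((INR k + 1) ^ 2 - x ^ 2)) N)).
  { intros N.
    assert (H0 : is_RInt (fun u => q u * / 2) 0 PI (sin (PI * x) / (2 * x) - PI * cos (PI * x) / 2)).
    { evar_last.
      { apply (is_RInt_derive (V := R_CompleteNormedModule)
                 (fun u => - sin (x * (PI - u)) / (2 * x) - cos (PI * x) * u / 2)).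
        - intros u _. unfold q. auto_derive; [exact I|].
          change (PI + - u) with (PI - u). field. lra.
        - intros u _. apply (ex_derive_continuous (fun u => q u * / 2)). unfold q.
          auto_derive. exact I. }
      cbv [minus plus opp]; simpl.
      rewrite Rminus_diag, Rmult_0_r, sin_0, Rminus_0_r, (Rmult_comm x PI). field. lra. }
    pose proof (is_RInt_sum_n _ _ 0 PI N (fun k => is_RInt_cos_kernel_term x k Hx)) as H1.
    rewrite sum_n_mul_l in H1.
    eapply is_RInt_ext; [|evar_last; [apply (is_RInt_plus _ _ _ _ _ _ H0 H1)|]].
    - intros u _. cbv [plus]; simpl. rewrite sum_n_mul_l. unfold q. ring.
    - cbv [plus]; simpl. ring. }
  assert (Hlim : is_lim_seq (fun N => RInt (fun u => h u * sin ((1 * (INR N + 1) + / 2) * u + 0)) 0 PI) 0).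
  { set (h' := fun u =>
      x * (((- x / 2) * cos (x * (PI - u / 2)) * sinc (x * u / 2)
            + sin (x * (PI - u / 2)) * (x / 2 * dsinc (x * u / 2))) * sinc (u / 2)
          - sin (x * (PI - u / 2)) * sinc (x * u / 2) * (dsinc (u / 2) / 2)) / sinc (u / 2) ^ 2).
    apply (oscillatory_integral_lim h h'); [lra | lra | |].
    - intros u Hu. unfold h, h'. specialize (Hsinc u Hu).
      auto_derive; [repeat split; auto using ex_derive_sinc|].
      rewrite !Derive_sinc. unfold Rdiv, Rminus in *. field. exact Hsinc.
    - intros u Hu. apply (ex_derive_continuous h'). unfold h'. specialize (Hsinc u Hu).
      auto_derive; repeat split; auto using ex_derive_sinc, ex_derive_dsinc. }
  change (is_lim_seq (sum_n (fun k => x ^ 2 / ((INR k + 1) ^ 2 - x ^ 2)))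
            ((1 - xcot (PI * x)) / 2)).
  apply is_lim_seq_ext with (u := fun N => x / sin (PI * x) *
     (sin (PI * x) / (2 * x) - PI * cos (PI * x) / 2
      - RInt (fun u => h u * sin ((1 * (INR N + 1) + / 2) * u + 0)) 0 PI)).
  { intros N.
    assert (HR : RInt (fun u => h u * sin ((1 * (INR N + 1) + / 2) * u + 0)) 0 PI =
      sin (PI * x) / (2 * x) - PI * cos (PI * x) / 2
       - sin (PI * x) / x * sum_n (fun k => x ^ 2 / ((INR k + 1) ^ 2 - x ^ 2)) N).
    { apply is_RInt_unique. eapply is_RInt_ext; [|apply HI].
      intros u. rewrite Rmin_left, Rmax_right by lra. intros Hu. simpl.
      rewrite Hq by lra. rewrite Rplus_0_r, Rmult_1_l, <- Dirichlet_kernel_cos. ring. }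
    rewrite HR. field. lra. }
  replace (Finite ((1 - xcot (PI * x)) / 2)) with
    (Finite (x / sin (PI * x) * (sin (PI * x) / (2 * x) - PI * cos (PI * x) / 2 - 0))).
  - apply (is_lim_seq_scal_l _ (x / sin (PI * x)) (Finite _)).
    apply is_lim_seq_minus'; [apply is_lim_seq_const | exact Hlim].
  - f_equal. unfold xcot. rewrite <- (mul_sinc (PI * x)).
    field. repeat split; try lra. apply sinc_neq_0; nra.
Qed.

(** * Power series with coefficients zeta(2n) *)

(** Comparison with the partial fraction series at x = 1/2, whose terms are a
    quarter of 1 / ((k+1)^2 - 1/4). *)
Lemma ex_series_inv_pow (m : nat) : (2 <= m)%nat ->
  ex_series (fun k => / (INR k + 1) ^ m).
Proof.
  intros Hm.
  apply (ex_series_le (K := R_AbsRing) (V := R_CompleteNormedModule) _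
    (fun k => 4 * ((/ 2) ^ 2 / ((INR k + 1) ^ 2 - (/ 2) ^ 2)))).
  - intros k. pose proof (INR_plus_1_ge_1 k) as Hk.
    cbv [norm]; simpl. cbv [abs]; simpl.
    assert (H1 : 0 < (INR k + 1) ^ 2) by (apply pow_lt; lra).
    assert (H3 : (INR k + 1) ^ 2 <= (INR k + 1) ^ m) by (apply Rle_pow; lra || lia).
    assert (H4 : / 2 * (/ 2 * 1) < (INR k + 1) ^ 2) by (simpl; nra).
    rewrite Rabs_pos_eq by (apply Rlt_le, Rinv_0_lt_compat; lra).
    simpl in *.
    replace (4 * (/ 2 * (/ 2 * 1) / ((INR k + 1) * ((INR k + 1) * 1) - / 2 * (/ 2 * 1))))
      with (/ ((INR k + 1) * ((INR k + 1) * 1) - / 2 * (/ 2 * 1))) by (field; nra).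
    apply Rinv_le_contravar; lra.
  - eexists. apply is_series_scal_R, cot_partial_fractions. lra.
Qed.

Lemma zeta_INR (m : nat) : (2 <= m)%nat ->
  is_series (fun k => / (INR k + 1) ^ m) (zeta (INR m)).
Proof.
  intros Hm. unfold zeta.
  rewrite (Series_ext _ (fun k => / (INR k + 1) ^ m)).
  - apply Series_correct, ex_series_inv_pow, Hm.
  - intros k. pose proof (INR_plus_1_ge_1 k).
    rewrite plus_INR. simpl (INR 1). rewrite Rpower_pow by lra. reflexivity.
Qed.

Lemma geometric_even_sum (y : R) (N : nat) :
  sum_n (fun n => y ^ (2 * (n + 1))) N * (1 - y ^ 2) = y ^ 2 * (1 - y ^ (2 * (N + 1))).
Proof.
  induction N as [|N IH].
  - rewrite sum_O. simpl. ring.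
  - rewrite sum_Sn_R, Rmult_plus_distr_r, IH.
    replace (2 * (S N + 1))%nat with (2 + 2 * (N + 1))%nat by lia.
    rewrite pow_add. ring.
Qed.

(** With y = x / (k+1), the fraction y^2 / (1 - y^2) exceeds the sum of its
    first N+1 even powers by exactly y^(2(N+1)) y^2 / (1 - y^2), at most
    x^(2(N+1)) times the fraction.  Summing over k, the fractions
    add up to (1 - pi x cot(pi x)) / 2, which is at most 1/2 as the cotangent
    is nonnegative on (0, pi/2]. *)
Lemma zeta_expansion_remainder (x : R) (N : nat) : 0 < x <= / 2 ->
  0 <= (1 - xcot (PI * x)) / 2 - sum_n (fun n => zeta (2 * INR (n + 1)) * x ^ (2 * (n + 1))) N
    <= x ^ (2 * (N + 1)) / 2.
Proof.
  intros Hx. pose proof PI_RGT_0 as Hpi.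
  assert (Hz : is_series (fun k => sum_n (fun n => (x / (INR k + 1)) ^ (2 * (n + 1))) N)
                 (sum_n (fun n => zeta (2 * INR (n + 1)) * x ^ (2 * (n + 1))) N)).
  { apply is_series_sum_n. intros n.
    replace (2 * INR (n + 1)) with (INR (2 * (n + 1))) by (rewrite mult_INR; reflexivity).
    rewrite Rmult_comm.
    eapply is_series_ext_R; [|apply is_series_scal_R, zeta_INR; lia].
    intros k. simpl. unfold Rdiv. rewrite Rpow_mult_distr, pow_inv. reflexivity. }
  pose proof (cot_partial_fractions x) as Hc.
  assert (Hx1 : 0 < x < 1) by lra. specialize (Hc Hx1).
  pose proof (is_series_plus_R _ _ _ _ Hc (is_series_scal_R (-1) _ _ Hz)) as Hd.
  assert (Hxc : 0 <= xcot (PI * x)).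
  { unfold xcot. apply Rmult_le_pos; [apply cos_ge_0; nra|].
    apply Rlt_le, Rinv_0_lt_compat, sinc_pos. nra. }
  assert (Hk : forall k, 0 <= x ^ 2 / ((INR k + 1) ^ 2 - x ^ 2)
      + -1 * sum_n (fun n => (x / (INR k + 1)) ^ (2 * (n + 1))) N
      <= x ^ (2 * (N + 1)) * (x ^ 2 / ((INR k + 1) ^ 2 - x ^ 2))).
  { intros k. pose proof (INR_plus_1_ge_1 k) as Hk.
    set (y := x / (INR k + 1)).
    assert (Hy : 0 < y <= x).
    { unfold y, Rdiv. assert (0 < / (INR k + 1) <= 1).
      { split; [apply Rinv_0_lt_compat; lra|]. rewrite <- Rinv_1.
        apply Rinv_le_contravar; lra. }
      nra. }
    assert (Hy2 : 0 < 1 - y ^ 2) by (simpl; nra).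
    replace (x ^ 2 / ((INR k + 1) ^ 2 - x ^ 2)) with (y ^ 2 / (1 - y ^ 2)).
    2:{ unfold y. field. repeat split; try nra. }
    pose proof (geometric_even_sum y N) as Hg.
    replace (sum_n (fun n => y ^ (2 * (n + 1))) N)
      with (y ^ 2 / (1 - y ^ 2) * (1 - y ^ (2 * (N + 1))))
      by (apply Rmult_eq_reg_r with (1 - y ^ 2); [rewrite Hg; field; lra | lra]).
    replace (y ^ 2 / (1 - y ^ 2) + -1 * (y ^ 2 / (1 - y ^ 2) * (1 - y ^ (2 * (N + 1)))))
      with (y ^ (2 * (N + 1)) * (y ^ 2 / (1 - y ^ 2))) by ring.
    assert (0 <= y ^ 2 / (1 - y ^ 2)).
    { apply Rmult_le_pos; [apply pow2_ge_0 | apply Rlt_le, Rinv_0_lt_compat, Hy2]. }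
    split.
    - apply Rmult_le_pos; [apply pow_le; lra | assumption].
    - apply Rmult_le_compat_r; [assumption|]. apply pow_incr. lra. }
  split.
  - assert (0 * ((1 - xcot (PI * x)) / 2) <= (1 - xcot (PI * x)) / 2 +
       -1 * sum_n (fun n => zeta (2 * INR (n + 1)) * x ^ (2 * (n + 1))) N).
    { eapply is_series_le_R; [|apply (is_series_scal_R 0 _ _ Hc)|exact Hd].
      intros k; simpl. rewrite Rmult_0_l. apply Hk. }
    lra.
  - assert ((1 - xcot (PI * x)) / 2 +
       -1 * sum_n (fun n => zeta (2 * INR (n + 1)) * x ^ (2 * (n + 1))) N
       <= x ^ (2 * (N + 1)) * ((1 - xcot (PI * x)) / 2)).
    { eapply is_series_le_R; [|exact Hd|apply (is_series_scal_R _ _ _ Hc)].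
      intros k; apply Hk. }
    assert (0 <= x ^ (2 * (N + 1))) by (apply pow_le; lra).
    nra.
Qed.

(** The interval [0, pi/2] has length a quarter of 2 pi, whence the powers
    of 16. *)
Lemma pow_div_2PI (t : R) (n : nat) : (t / (2 * PI)) ^ (2 * n) = t ^ (2 * n) / (PI / 2) ^ (2 * n) / 16 ^ n.
Proof.
  pose proof PI_RGT_0.
  replace 16 with (4 ^ 2) by ring. rewrite <- pow_mult.
  unfold Rdiv at 2 3. rewrite <- !pow_inv, <- !Rpow_mult_distr.
  f_equal. field. lra.
Qed.

Lemma quarter_range (t : R) : 0 <= t <= PI / 2 -> 0 <= t / 2 < PI.
Proof. pose proof PI_RGT_0. lra. Qed.

Definition cot_moment (m : nat) : R := RInt (fun t => t ^ m * xcot (t / 2)) 0 (PI / 2).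

Lemma cot_moment_correct (m : nat) :
  is_RInt (fun t => t ^ m * xcot (t / 2)) 0 (PI / 2) (cot_moment m).
Proof.
  apply (RInt_correct (V := R_CompleteNormedModule) (fun t => t ^ m * xcot (t / 2))).
  apply (ex_RInt_continuous (V := R_CompleteNormedModule)).
  intros t. pose proof PI_RGT_0. rewrite Rmin_left, Rmax_right by lra. intros Ht.
  apply (ex_derive_continuous (fun t => t ^ m * xcot (t / 2))).
  auto_derive. apply (ex_derive_xcot (t / 2) (quarter_range t Ht)).
Qed.

(** The expansion of (1 - (t/2) cot(t/2)) / 2 multiplied by t^m and integrated
    over [0, pi/2].  The remainder after N+1 terms is at most 16^-(N+1) / 2
    on this interval, so its integral tends to 0. *)
Lemma zeta_moment_series (m : nat) :
  is_series_from1 (fun n => zeta (2 * INR n) / ((2 * INR n + INR m + 1) * 16 ^ n))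
    ((1 / (INR m + 1) - cot_moment m / (PI / 2) ^ (m + 1)) / 2).
Proof.
  pose proof PI_RGT_0 as Hpi.
  set (a := PI / 2). assert (Ha : 0 < a) by (unfold a; lra).
  assert (Ham : 0 < a ^ (m + 1)) by (apply pow_lt, Ha).
  pose proof (INR_plus_1_ge_1 m) as Hm.
  apply (is_series_from1_squeeze _ _ (/ 32) (/ 16)); [rewrite Rabs_pos_eq; lra|]. intros N.
  set (L := (1 / (INR m + 1) - cot_moment m / a ^ (m + 1)) / 2).
  set (S := sum_n _ N).
  assert (HS : is_RInt (fun t => t ^ m * sum_n (fun n => zeta (2 * INR (n + 1)) * (t / (2 * PI)) ^ (2 * (n + 1))) N)
     0 a (a ^ (m + 1) * S)).
  { unfold S. rewrite <- sum_n_mul_l.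
    eapply is_RInt_ext; [|apply (is_RInt_sum_n (fun n t => t ^ m * (zeta (2 * INR (n + 1)) * (t / (2 * PI)) ^ (2 * (n + 1)))))].
    - intros t _. simpl. rewrite <- sum_n_mul_l. reflexivity.
    - intros n.
      eapply is_RInt_eq; [| |apply (is_RInt_scal_R (fun t => t ^ (m + 2 * (n + 1))) 0 a
        (zeta (2 * INR (n + 1)) / a ^ (2 * (n + 1)) / 16 ^ (n + 1))), is_RInt_monomial].
      { intros t. cbv beta. rewrite pow_div_2PI, (pow_add t m). fold a. field. split; apply pow_nonzero; lra. }
      replace (m + 2 * (n + 1) + 1)%nat with ((m + 1) + 2 * (n + 1))%nat by lia.
      rewrite (pow_add a (m + 1)), (plus_INR m), (mult_INR 2), (plus_INR n 1). simpl (INR 2). simpl (INR 1).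
      pose proof (pos_INR n). field.
      repeat split; try lra; apply pow_nonzero; lra. }
  assert (HD : is_RInt (fun t => t ^ m * ((1 - xcot (t / 2)) / 2
       - sum_n (fun n => zeta (2 * INR (n + 1)) * (t / (2 * PI)) ^ (2 * (n + 1))) N))
     0 a (a ^ (m + 1) * (L - S))).
  { pose proof (is_RInt_minus_R _ _ _ _ _ _ (is_RInt_monomial m a) (cot_moment_correct m)) as H1.
    pose proof (is_RInt_minus_R _ _ _ _ _ _ (is_RInt_scal_R _ _ _ (/ 2) _ H1) HS) as H2.
    eapply is_RInt_eq; [| |exact H2].
    - intros t. simpl. field.
    - unfold L. field. split; lra. }
  assert (Hbound : forall t, 0 < t < a ->
     0 <= (1 - xcot (t / 2)) / 2
       - sum_n (fun n => zeta (2 * INR (n + 1)) * (t / (2 * PI)) ^ (2 * (n + 1))) N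
     <= / 32 * (/ 16) ^ N).
  { intros t Ht.
    assert (Hx : 0 < t / (2 * PI) < / 4).
    { split; [apply Rdiv_lt_0_compat; lra|].
      apply (Rmult_lt_reg_r (2 * PI)); [lra|]. unfold a in Ht. field_simplify; lra. }
    pose proof (zeta_expansion_remainder (t / (2 * PI)) N) as HR.
    replace (PI * (t / (2 * PI))) with (t / 2) in HR by (field; lra).
    destruct HR as [H1 H2]; [lra|]. split; [exact H1|].
    eapply Rle_trans; [exact H2|].
    rewrite pow_mult.
    replace (/ 32 * (/ 16) ^ N) with ((/ 16) ^ (N + 1) / 2) by (rewrite pow_add; simpl; field).
    apply Rmult_le_compat_r; [lra|]. apply pow_incr. split; [apply pow2_ge_0|]. simpl. nra. }
  (* t^m >= 0, so the bounds on the remainder pass to the integrals *)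
  assert (H0 : is_RInt (fun t => t ^ m * 0) 0 a 0).
  { eapply is_RInt_eq; [| |apply (is_RInt_scal_R _ _ _ 0 _ (is_RInt_monomial m a))].
    - intros t. simpl. ring.
    - ring. }
  assert (HC : is_RInt (fun t => t ^ m * (/ 32 * (/ 16) ^ N)) 0 a (/ 32 * (/ 16) ^ N * (a ^ (m + 1) / (INR m + 1)))).
  { eapply is_RInt_eq; [| |apply (is_RInt_scal_R _ _ _ (/ 32 * (/ 16) ^ N) _ (is_RInt_monomial m a))].
    - intros t. simpl. ring.
    - reflexivity. }
  assert (Hlo : 0 <= a ^ (m + 1) * (L - S)).
  { apply (is_RInt_le _ _ _ _ _ _ (Rlt_le _ _ Ha) H0 HD).
    intros t Ht. apply Rmult_le_compat_l; [apply pow_le; lra | apply Hbound, Ht]. }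
  assert (Hhi : a ^ (m + 1) * (L - S) <= / 32 * (/ 16) ^ N * (a ^ (m + 1) / (INR m + 1))).
  { apply (is_RInt_le _ _ _ _ _ _ (Rlt_le _ _ Ha) HD HC).
    intros t Ht. apply Rmult_le_compat_l; [apply pow_le; lra | apply Hbound, Ht]. }
  split.
  - apply (Rmult_le_reg_l (a ^ (m + 1))); lra.
  - apply (Rmult_le_reg_l (a ^ (m + 1))); [exact Ham|].
    eapply Rle_trans; [exact Hhi|].
    assert (0 < (/ 16) ^ N) by (apply pow_lt; lra).
    assert (Hinv : / (INR m + 1) <= 1) by (rewrite <- Rinv_1; apply Rinv_le_contravar; lra).
    unfold Rdiv. replace (/ 32 * (/ 16) ^ N * (a ^ (m + 1) * / (INR m + 1)))
      with (a ^ (m + 1) * (/ 32 * (/ 16) ^ N) * / (INR m + 1)) by ring.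
    rewrite <- (Rmult_1_r (a ^ (m + 1) * _)) at 2.
    apply Rmult_le_compat_l; [nra | exact Hinv].
Qed.

(** The derivative of - ln (sinc (t/2)) is (1 - (t/2) cot(t/2)) / t, that is,
    2/t times the expanded function.  The difference E between this function
    and the partial sum therefore has a small derivative on (0, pi/2) and
    vanishes at 0, and the mean value theorem bounds it at pi/2, where
    sinc(pi/4) = (4 / pi) / sqrt 2. *)
Lemma zeta_log_series :
  is_series_from1 (fun n => zeta (2 * INR n) / (INR n * 16 ^ n)) (ln (PI / 2) - ln 2 / 2).
Proof.
  pose proof PI_RGT_0 as Hpi.
  assert (Hl : ln (PI / 2) - ln 2 / 2 = - ln (sinc (PI / 2 / 2))).
  { replace (sinc (PI / 2 / 2)) with (/ (PI / 2) * (2 / sqrt 2)).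
    2:{ apply (Rmult_eq_reg_l (PI / 4)); [|lra].
        replace (PI / 2 / 2) with (PI / 4) by field.
        rewrite mul_sinc, sin_PI4. field. pose proof (sqrt_lt_R0 2). lra. }
    assert (H2 : 0 < sqrt 2) by (apply sqrt_lt_R0; lra).
    assert (H3 : 2 / sqrt 2 = sqrt 2).
    { rewrite <- (sqrt_sqrt 2) at 1 by lra. field. lra. }
    rewrite H3, ln_mult, ln_Rinv; [|lra|apply Rinv_0_lt_compat; lra|exact H2].
    assert (H4 : ln 2 = ln (sqrt 2) + ln (sqrt 2)).
    { rewrite <- ln_mult by exact H2. rewrite sqrt_sqrt by lra. reflexivity. }
    lra. }
  rewrite Hl.
  apply (is_series_from1_squeeze _ _ 1 (/ 16)); [rewrite Rabs_pos_eq; lra|]. intros N.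
  set (T := fun (n : nat) (t : R) => zeta (2 * INR (n + 1)) / (INR (n + 1)) * (t / (2 * PI)) ^ (2 * (n + 1))).
  set (T' := fun (n : nat) (t : R) => zeta (2 * INR (n + 1)) * (t / (2 * PI)) ^ (2 * n + 1) / PI).
  assert (HTd : forall n t, is_derive (T n) t (T' n t)).
  { intros n t. unfold T, T'. auto_derive; [exact I|].
    replace (pred (n + 1 + (n + 1 + 0)))%nat with (2 * n + 1)%nat by lia.
    replace (n + 1 + (n + 1 + 0))%nat with (2 * (n + 1))%nat by lia.
    rewrite mult_INR. simpl (INR 2). unfold Rdiv.
    assert (0 < INR (n + 1)) by (apply lt_0_INR; lia). field. lra. }
  set (E := fun t => - ln (sinc (t / 2)) - sum_n (fun n => T n t) N).
  set (E' := fun t => - dsinc (t / 2) / (2 * sinc (t / 2)) - sum_n (fun n => T' n t) N).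
  assert (HE : forall t, 0 <= t <= PI / 2 -> derivable_pt_lim E t (E' t)).
  { intros t Ht. apply is_derive_Reals.
    pose proof (sinc_pos _ (quarter_range t Ht)) as Hs.
    apply (is_derive_minus (V := R_NormedModule) (fun t => - ln (sinc (t / 2)))).
    - auto_derive; [repeat split; [apply ex_derive_sinc | exact Hs]|].
      rewrite Derive_sinc. unfold Rdiv in *. field. lra.
    - apply (is_derive_sum_n (K := R_AbsRing) (V := R_NormedModule) T N t (fun n => T' n t)). intros n _; apply HTd. }
  destruct (MVT_cor2 E E' 0 (PI / 2)) as [c [Hc1 Hc2]]; [lra | exact HE |].
  replace (E 0) with 0 in Hc1.
  2:{ unfold E. replace (0 / 2) with 0 by field. rewrite sinc_0, ln_1.
      rewrite (sum_n_ext_R _ (fun n => 0 * T n 1)).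
      - rewrite sum_n_mul_l. ring.
      - intros n. unfold T. unfold Rdiv at 2. rewrite Rmult_0_l, pow_i by lia. ring. }
  (* as dsinc y = (cos y - sinc y) / y, at the intermediate point E' is 2/c
     times the remainder of the expansion *)
  assert (HcE : E' c = 2 / c * ((1 - xcot (c / 2)) / 2
       - sum_n (fun n => zeta (2 * INR (n + 1)) * (c / (2 * PI)) ^ (2 * (n + 1))) N)).
  { unfold E'. rewrite Rmult_minus_distr_l, <- sum_n_mul_l. f_equal.
    - pose proof (sinc_add_mul_dsinc (c / 2)). unfold xcot. rewrite <- H.
      field. split; [|lra]. apply sinc_neq_0; lra.
    - apply sum_n_ext_R. intros n. unfold T'.
      replace (2 * (n + 1))%nat with (S (2 * n + 1)) by lia.
      rewrite <- (tech_pow_Rmult _ (2 * n + 1)). field. lra. }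
  assert (Hx : 0 < c / (2 * PI) < / 4).
  { split; [apply Rdiv_lt_0_compat; lra|].
    apply (Rmult_lt_reg_r (2 * PI)); [lra|]. field_simplify; lra. }
  pose proof (zeta_expansion_remainder (c / (2 * PI)) N) as HR.
  replace (PI * (c / (2 * PI))) with (c / 2) in HR by (field; lra).
  destruct HR as [HR1 HR2]; [lra|].
  set (rho := (1 - xcot (c / 2)) / 2 - _) in *.
  assert (Hrho : 2 / c * rho <= / PI * (/ 16) ^ N).
  { replace (2 / c * rho) with (/ PI * (rho / (c / (2 * PI)))) by (field; lra).
    apply Rmult_le_compat_l; [apply Rlt_le, Rinv_0_lt_compat; lra|].
    apply (Rmult_le_reg_r (c / (2 * PI))); [lra|].
    unfold Rdiv at 1. rewrite Rmult_assoc, Rinv_l, Rmult_1_r by lra.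
    eapply Rle_trans; [exact HR2|].
    rewrite pow_mult, pow_add, pow_1. set (x := c / (2 * PI)) in *.
    assert ((x ^ 2) ^ N <= (/ 16) ^ N) by (apply pow_incr; split; [apply pow2_ge_0 | simpl; nra]).
    assert (0 <= (x ^ 2) ^ N) by (apply pow_le, pow2_ge_0).
    assert (0 <= x ^ 2 <= x) by (simpl; nra).
    apply Rle_trans with ((x ^ 2) ^ N * x); nra. }
  assert (Hlow : 0 <= 2 / c * rho).
  { apply Rmult_le_pos; [|exact HR1]. apply Rlt_le, Rdiv_lt_0_compat; lra. }
  (* at t = pi/2 the powers (t / 2pi)^(2n) are 16^-n *)
  replace (- ln (sinc (PI / 2 / 2)) - _) with (E (PI / 2)).
  2:{ unfold E. f_equal. apply sum_n_ext_R. intros n. unfold T. rewrite pow_div_2PI.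
      assert (0 < INR (n + 1)) by (apply lt_0_INR; lia).
      field. repeat split; try lra; apply pow_nonzero; lra. }
  rewrite HcE in Hc1. rewrite !Rminus_0_r in Hc1. rewrite Hc1.
  assert (0 < (/ 16) ^ N) by (apply pow_lt; lra).
  split; [nra|].
  apply Rle_trans with (/ PI * (/ 16) ^ N * (PI / 2)); [apply Rmult_le_compat_r; lra|].
  field_simplify; lra.
Qed.

(** * Sine series of the cotangent moments *)

(** Multiplied by t^(m+1), the kernel identity for the sine sums reads
    partial sum = t^m (t/2) cot(t/2) - (t^m / sinc(t/2)) cos((2N + 5/2) t), and
    the last term is oscillatory with a C^1 amplitude. *)
Lemma cot_moment_sine_series (m : nat) (J : R -> R) :
  (forall nu, 0 < nu -> is_RInt (fun t => t ^ (m + 1) * sin (nu * t)) 0 (PI / 2) (J nu)) ->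
  is_series (fun j => J (2 * INR j + 1) + J (2 * INR j + 2)) (cot_moment m).
Proof.
  intros HJ. pose proof PI_RGT_0 as Hpi.
  set (a := PI / 2). assert (Ha : 0 < a) by (unfold a; lra).
  set (f := fun t => t ^ m / sinc (t / 2)).
  assert (Hsinc : forall t, 0 <= t <= a -> sinc (t / 2) <> 0)
    by (intros t Ht; apply sinc_neq_0, quarter_range, Ht).
  assert (HI : forall N, is_RInt (fun t => t ^ (m + 1) *
      sum_n (fun j => sin ((2 * INR j + 1) * t) + sin ((2 * INR j + 2) * t)) N) 0 a
      (sum_n (fun j => J (2 * INR j + 1) + J (2 * INR j + 2)) N)).
  { intros N.
    eapply is_RInt_eq; [|reflexivity|apply (is_RInt_sum_n (fun j t =>
       t ^ (m + 1) * sin ((2 * INR j + 1) * t) + t ^ (m + 1) * sin ((2 * INR j + 2) * t)))].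
    - intros t. cbv beta. rewrite <- sum_n_mul_l. apply sum_n_ext_R. intros j. ring.
    - intros j. pose proof (pos_INR j). apply is_RInt_plus_R; apply HJ; lra. }
  set (r := fun N t => f t * sin ((2 * (INR N + 1) + / 2) * t + PI / 2)).
  assert (Hlim : is_lim_seq (fun N => RInt (r N) 0 a) 0).
  { set (f' := fun t => (INR m * t ^ pred m * sinc (t / 2) - t ^ m * (dsinc (t / 2) / 2)) / sinc (t / 2) ^ 2).
    apply (oscillatory_integral_lim f f'); [lra | lra | |].
    - intros t Ht. unfold f, f'. specialize (Hsinc t Ht).
      auto_derive; [repeat split; auto using ex_derive_sinc|].
      rewrite !Derive_sinc. unfold Rdiv in *. field. exact Hsinc.
    - intros t Ht. apply (ex_derive_continuous f'). unfold f'. specialize (Hsinc t Ht).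
      auto_derive; repeat split; auto using ex_derive_sinc, ex_derive_dsinc. }
  change (is_lim_seq (sum_n (fun j => J (2 * INR j + 1) + J (2 * INR j + 2))) (cot_moment m)).
  apply is_lim_seq_ext with (u := fun N => cot_moment m - RInt (r N) 0 a).
  - intros N.
    assert (HR : RInt (r N) 0 a = cot_moment m - sum_n (fun j => J (2 * INR j + 1) + J (2 * INR j + 2)) N).
    { apply is_RInt_unique.
      eapply (is_RInt_ext_R _ _ 0 a _ (Rlt_le _ _ Ha));
        [|apply (is_RInt_minus_R _ _ _ _ _ _ (cot_moment_correct m) (HI N))].
      intros t Ht. cbv beta. unfold r, f, xcot.
      rewrite sin_plus, sin_PI2, cos_PI2.
      pose proof (Dirichlet_kernel_sin t N) as Hk.
      assert (Hs : sinc (t / 2) <> 0) by (apply Hsinc; lra).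
      replace (2 * sin (t / 2)) with (t * sinc (t / 2)) in Hk
        by (rewrite <- (mul_sinc (t / 2)); field).
      set (C := sum_n _ N) in *.
      replace (cos (t / 2)) with (C * (t * sinc (t / 2)) + cos ((2 * (INR N + 1) + / 2) * t)) by lra.
      rewrite pow_add. field. exact Hs. }
    rewrite HR. ring.
  - replace (Finite (cot_moment m)) with (Finite (cot_moment m - 0)) by (f_equal; ring).
    apply is_lim_seq_minus'; [apply is_lim_seq_const | exact Hlim].
Qed.

(** [sine_moment_1], [sine_moment_2] and [sine_moment_3] are the integrals of
    t sin(nu t), t^2 sin(nu t) and t^3 sin(nu t) over [0, a]. *)
Definition sine_moment_1 (a nu : R) := - a * cos (nu * a) / nu + sin (nu * a) / nu ^ 2.

Definition sine_moment_2 (a nu : R) :=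
  - a ^ 2 * cos (nu * a) / nu + 2 * a * sin (nu * a) / nu ^ 2 + 2 * (cos (nu * a) - 1) / nu ^ 3.

Definition sine_moment_3 (a nu : R) :=
  - a ^ 3 * cos (nu * a) / nu + 3 * a ^ 2 * sin (nu * a) / nu ^ 2
  + 6 * a * cos (nu * a) / nu ^ 3 - 6 * sin (nu * a) / nu ^ 4.

Lemma is_RInt_sine_moment_1 (a nu : R) : 0 < nu ->
  is_RInt (fun t => t ^ (0 + 1) * sin (nu * t)) 0 a (sine_moment_1 a nu).
Proof.
  intros Hnu.
  eapply is_RInt_eq; [| |apply (is_RInt_antiderivative (fun t => sine_moment_1 t nu) (fun t => t * sin (nu * t)))].
  - intros t. simpl. ring.
  - unfold sine_moment_1. rewrite Rmult_0_r, sin_0. field. lra.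
  - intros t. unfold sine_moment_1. auto_derive; [lra|]. field. lra.
  - intros t. auto_derive. exact I.
Qed.

Lemma is_RInt_sine_moment_2 (a nu : R) : 0 < nu ->
  is_RInt (fun t => t ^ (1 + 1) * sin (nu * t)) 0 a (sine_moment_2 a nu).
Proof.
  intros Hnu.
  eapply is_RInt_eq; [| |apply (is_RInt_antiderivative (fun t => sine_moment_2 t nu) (fun t => t ^ 2 * sin (nu * t)))].
  - intros t. simpl. ring.
  - unfold sine_moment_2. rewrite Rmult_0_r, sin_0, cos_0. field. lra.
  - intros t. unfold sine_moment_2. auto_derive; [lra|]. field. lra.
  - intros t. auto_derive. exact I.
Qed.

Lemma is_RInt_sine_moment_3 (a nu : R) : 0 < nu ->
  is_RInt (fun t => t ^ (2 + 1) * sin (nu * t)) 0 a (sine_moment_3 a nu).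
Proof.
  intros Hnu.
  eapply is_RInt_eq; [| |apply (is_RInt_antiderivative (fun t => sine_moment_3 t nu) (fun t => t ^ 3 * sin (nu * t)))].
  - intros t. simpl. ring.
  - unfold sine_moment_3. rewrite Rmult_0_r, sin_0, cos_0. field. lra.
  - intros t. unfold sine_moment_3. auto_derive; [lra|]. field. lra.
  - intros t. auto_derive. exact I.
Qed.

Lemma quarter_turns (j : nat) :
  cos ((2 * INR j + 1) * (PI / 2)) = 0 /\ sin ((2 * INR j + 1) * (PI / 2)) = (-1) ^ j /\
  cos ((2 * INR j + 2) * (PI / 2)) = - (-1) ^ j /\ sin ((2 * INR j + 2) * (PI / 2)) = 0.
Proof.
  replace ((2 * INR j + 1) * (PI / 2)) with (INR j * PI + PI / 2) by field.
  replace ((2 * INR j + 2) * (PI / 2)) with (INR j * PI + PI) by field.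
  assert (Hc : cos (INR j * PI) = (-1) ^ j).
  { induction j as [|j IH].
    - simpl. rewrite Rmult_0_l. apply cos_0.
    - rewrite S_INR, Rmult_plus_distr_r, Rmult_1_l, neg_cos, IH. simpl. ring. }
  rewrite !sin_plus, !cos_plus, sin_PI2, cos_PI2, sin_PI, cos_PI, sin_INR_PI, Hc.
  repeat split; ring.
Qed.

(** * Numerical series *)

(** Integrate 1 / (1 + t) minus a partial geometric sum over [0, 1]: the
    integrand is between -t^(N+1) and t^(N+1). *)
Lemma alternating_harmonic : is_series (fun j => (-1) ^ j / (INR j + 1)) (ln 2).
Proof.
  assert (Hg : forall t N, (1 + t) * sum_n (fun j => (-1) ^ j * t ^ j) N = 1 + (-1) ^ N * t ^ (N + 1)).
  { intros t N. induction N as [|N IH].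
    - rewrite sum_O. simpl. ring.
    - rewrite sum_Sn_R, Rmult_plus_distr_l, IH.
      replace (S N + 1)%nat with (S (S N)) by lia. replace (N + 1)%nat with (S N) by lia.
      simpl. ring. }
  assert (HI : forall N, is_RInt (fun t => / (1 + t) - sum_n (fun j => (-1) ^ j * t ^ j) N) 0 1
     (ln 2 - sum_n (fun j => (-1) ^ j / (INR j + 1)) N)).
  { intros N. apply is_RInt_minus_R.
    - evar_last.
      { apply (is_RInt_derive (V := R_CompleteNormedModule) (fun t => ln (1 + t))).
        - intros t. rewrite Rmin_left, Rmax_right by lra. intros Ht. auto_derive; [lra|]. field. lra.
        - intros t. rewrite Rmin_left, Rmax_right by lra. intros Ht.
          apply (ex_derive_continuous (fun t => / (1 + t))). auto_derive. lra. }
      cbv [minus plus opp]; simpl. rewrite Rplus_0_r, ln_1.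
      replace (1 + 1) with 2 by ring. ring.
    - apply (is_RInt_sum_n (fun j t => (-1) ^ j * t ^ j)). intros j.
      eapply is_RInt_eq; [| |apply (is_RInt_scal_R _ 0 1 ((-1) ^ j) _ (is_RInt_monomial j 1))].
      + intros t. reflexivity.
      + rewrite pow1. unfold Rdiv. ring. }
  assert (Hb : forall N t, 0 < t < 1 ->
     - t ^ (N + 1) <= / (1 + t) - sum_n (fun j => (-1) ^ j * t ^ j) N <= t ^ (N + 1)).
  { intros N t Ht. apply Rabs_le_between.
    replace (/ (1 + t) - _) with (- (-1) ^ N * t ^ (N + 1) * / (1 + t)).
    2:{ apply (Rmult_eq_reg_l (1 + t)); [|lra].
        rewrite Rmult_minus_distr_l, Hg. field. lra. }
    rewrite !Rabs_mult, Rabs_Ropp, pow_1_abs, Rmult_1_l.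
    assert (0 < t ^ (N + 1)) by (apply pow_lt; lra).
    assert (0 < / (1 + t) <= 1).
    { split; [apply Rinv_0_lt_compat; lra|]. rewrite <- Rinv_1. apply Rinv_le_contravar; lra. }
    rewrite !Rabs_pos_eq by lra. nra. }
  assert (HP : forall N, is_RInt (fun t => t ^ (N + 1)) 0 1 (/ (INR N + 2))).
  { intros N. pose proof (pos_INR N).
    eapply is_RInt_eq; [reflexivity| |apply (is_RInt_monomial (N + 1) 1)].
    rewrite pow1, plus_INR. simpl (INR 1). field. lra. }
  assert (HN : forall N, ln 2 - / (INR N + 2) <= sum_n (fun j => (-1) ^ j / (INR j + 1)) N <= ln 2 + / (INR N + 2)).
  { intros N.
    assert (-1 * / (INR N + 2) <= ln 2 - sum_n (fun j => (-1) ^ j / (INR j + 1)) N).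
    { apply (is_RInt_le _ _ _ _ _ _ Rle_0_1 (is_RInt_scal_R _ _ _ (-1) _ (HP N)) (HI N)).
      intros t Ht. specialize (Hb N t Ht). lra. }
    assert (ln 2 - sum_n (fun j => (-1) ^ j / (INR j + 1)) N <= / (INR N + 2)).
    { apply (is_RInt_le _ _ _ _ _ _ Rle_0_1 (HI N) (HP N)).
      intros t Ht. specialize (Hb N t Ht). lra. }
    lra. }
  assert (H0 : is_lim_seq (fun N => / (INR N + 2)) 0).
  { apply is_lim_seq_ext with (fun n => / INR (n + 2)); [intros n; rewrite plus_INR; reflexivity|].
    apply (is_lim_seq_incr_n (fun n => / INR n) 2).
    replace (Finite 0) with (Rbar_inv p_infty) by reflexivity.
    apply is_lim_seq_inv; [apply is_lim_seq_INR | discriminate]. }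
  change (is_lim_seq (sum_n (fun j => (-1) ^ j / (INR j + 1))) (ln 2)).
  eapply is_lim_seq_le_le; [exact HN | |].
  - replace (Finite (ln 2)) with (Finite (ln 2 - 0)) by (f_equal; ring).
    apply is_lim_seq_minus'; [apply is_lim_seq_const | exact H0].
  - replace (Finite (ln 2)) with (Finite (ln 2 + 0)) by (f_equal; ring).
    apply is_lim_seq_plus'; [apply is_lim_seq_const | exact H0].
Qed.

Lemma dirichlet_beta_INR (m : nat) : (2 <= m)%nat ->
  is_series (fun j => (-1) ^ j / (2 * INR j + 1) ^ m) (dirichlet_beta (INR m)).
Proof.
  intros Hm. unfold dirichlet_beta.
  rewrite (Series_ext _ (fun j => (-1) ^ j / (2 * INR j + 1) ^ m)).
  - apply Series_correct.
    apply (ex_series_le (K := R_AbsRing) (V := R_CompleteNormedModule) _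
             (fun j => / (INR j + 1) ^ m)); [|apply ex_series_inv_pow, Hm].
    intros j. pose proof (pos_INR j).
    change (Rabs ((-1) ^ j / (2 * INR j + 1) ^ m) <= / (INR j + 1) ^ m).
    unfold Rdiv. rewrite Rabs_mult, pow_1_abs, Rmult_1_l.
    assert (0 < (INR j + 1) ^ m) by (apply pow_lt; lra).
    assert ((INR j + 1) ^ m <= (2 * INR j + 1) ^ m) by (apply pow_incr; lra).
    rewrite Rabs_pos_eq; [apply Rinv_le_contravar; lra | apply Rlt_le, Rinv_0_lt_compat; lra].
  - intros j. pose proof (pos_INR j).
    rewrite plus_INR, mult_INR. simpl (INR 1). simpl (INR 2).
    rewrite Rpower_pow by lra. reflexivity.
Qed.

Lemma catalan_series : is_series (fun j => (-1) ^ j / (2 * INR j + 1) ^ 2) Catalan.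
Proof.
  unfold Catalan. replace 2 with (INR 2) at 2 by (simpl; ring).
  apply (dirichlet_beta_INR 2). lia.
Qed.

Lemma beta_4_series : is_series (fun j => (-1) ^ j / (2 * INR j + 1) ^ 4) (dirichlet_beta 4).
Proof.
  replace (dirichlet_beta 4) with (dirichlet_beta (INR 4)) by (f_equal; simpl; ring).
  apply dirichlet_beta_INR. lia.
Qed.

(** The form of zeta(3) produced by the sine sums, which are taken in pairs. *)
Lemma zeta_3_pairs :
  is_series (fun j => / (2 * INR j + 1) ^ 3 + / (2 * INR j + 2) ^ 3) (zeta 3).
Proof.
  replace 3 with (INR 3) by (simpl; ring).
  eapply is_series_ext_R; [|apply is_series_pairs, (zeta_INR 3); lia].
  intros j. cbv beta. rewrite plus_INR, mult_INR. simpl (INR 1). simpl (INR 2).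
  replace ((1 + 1) * INR j) with (2 * INR j) by ring.
  replace (2 * INR j + 1 + 1) with (2 * INR j + 2) by ring. reflexivity.
Qed.

(** The alternating sum converges absolutely, so it may be summed in pairs
    and compared with zeta(3). *)
Lemma eta_3 : is_series (fun j => (-1) ^ j / (INR j + 1) ^ 3) (3 / 4 * zeta 3).
Proof.
  assert (Hz : is_series (fun k => / (INR k + 1) ^ 3) (zeta 3)).
  { replace (zeta 3) with (zeta (INR 3)) by (f_equal; simpl; ring). apply zeta_INR. lia. }
  assert (He : ex_series (fun j => (-1) ^ j / (INR j + 1) ^ 3)).
  { apply (ex_series_le (K := R_AbsRing) (V := R_CompleteNormedModule) _
             (fun j => / (INR j + 1) ^ 3)); [|eexists; exact Hz].
    intros j. pose proof (INR_plus_1_ge_1 j).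
    change (Rabs ((-1) ^ j / (INR j + 1) ^ 3) <= / (INR j + 1) ^ 3).
    unfold Rdiv. rewrite Rabs_mult, pow_1_abs, Rmult_1_l, Rabs_pos_eq; [lra|].
    apply Rlt_le, Rinv_0_lt_compat, pow_lt. lra. }
  destruct He as [l Hl].
  replace (3 / 4 * zeta 3) with l; [exact Hl|].
  assert (E : l = zeta 3 + - / 4 * zeta 3).
  { (* odd minus even terms = all terms minus twice the even ones, and the
       even terms of zeta(3) add up to zeta(3) / 8 *)
    eapply is_series_eq;
      [apply is_series_pairs, Hl
      |apply (is_series_plus_R _ _ _ _ zeta_3_pairs (is_series_scal_R (- / 4) _ _ Hz))|].
    intros j. cbv beta. pose proof (pos_INR j).
    rewrite pow_add, pow_mult, plus_INR, mult_INR. simpl (INR 1). simpl (INR 2).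
    replace ((-1) ^ 2) with 1 by ring. rewrite pow1. field. lra. }
  rewrite E. change (zeta 3 + - / 4 * zeta 3 = 3 / 4 * zeta 3). field.
Qed.

(** * The moments in closed form and the three identities *)

Lemma cot_moment_0 : cot_moment 0 = PI / 4 * ln 2 + Catalan.
Proof.
  eapply is_series_eq.
  - apply (cot_moment_sine_series 0 (sine_moment_1 (PI / 2))). intros nu; apply is_RInt_sine_moment_1.
  - apply is_series_plus_R; [apply (is_series_scal_R _ _ _ alternating_harmonic) | apply catalan_series].
  - intros j. pose proof (pos_INR j). destruct (quarter_turns j) as (E1 & E2 & E3 & E4).
    unfold sine_moment_1. rewrite E1, E2, E3, E4. field. lra.
Qed.

(** The two multiples of zeta(3) come from (cos(nu pi/2) - 1) / nu^3: the
    cosine gives an alternating sum over even nu, the constant the sum over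
    all nu. *)
Lemma cot_moment_1 : cot_moment 1 = PI ^ 2 / 8 * ln 2 + PI * Catalan - 35 / 16 * zeta 3.
Proof.
  assert (H : cot_moment 1 = PI ^ 2 / 8 * ln 2 + (PI * Catalan + (- / 4 * (3 / 4 * zeta 3) + -2 * zeta 3)));
    [|rewrite H; field].
  eapply is_series_eq.
  - apply (cot_moment_sine_series 1 (sine_moment_2 (PI / 2))). intros nu; apply is_RInt_sine_moment_2.
  - repeat apply is_series_plus_R; apply is_series_scal_R.
    + apply alternating_harmonic.
    + apply catalan_series.
    + apply eta_3.
    + apply zeta_3_pairs.
  - intros j. pose proof (pos_INR j). destruct (quarter_turns j) as (E1 & E2 & E3 & E4).
    unfold sine_moment_2. rewrite E1, E2, E3, E4. field. lra.
Qed.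

Lemma cot_moment_2 :
  cot_moment 2 = PI ^ 3 / 16 * ln 2 + 3 * PI ^ 2 / 4 * Catalan - 9 / 32 * PI * zeta 3
                 - 6 * dirichlet_beta 4.
Proof.
  assert (H : cot_moment 2 = PI ^ 3 / 16 * ln 2 + (3 * PI ^ 2 / 4 * Catalan
     + (- (3 / 8 * PI) * (3 / 4 * zeta 3) + -6 * dirichlet_beta 4)));
    [|rewrite H; field].
  eapply is_series_eq.
  - apply (cot_moment_sine_series 2 (sine_moment_3 (PI / 2))). intros nu; apply is_RInt_sine_moment_3.
  - repeat apply is_series_plus_R; apply is_series_scal_R.
    + apply alternating_harmonic.
    + apply catalan_series.
    + apply eta_3.
    + apply beta_4_series.
  - intros j. pose proof (pos_INR j). destruct (quarter_turns j) as (E1 & E2 & E3 & E4).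
    unfold sine_moment_3. rewrite E1, E2, E3, E4. field. lra.
Qed.

Theorem theorem2p2 :
  (exists S1 : R,
     is_series_from1
       (fun n : nat =>
          zeta (2 * INR n) /
            (INR n * (INR n + 1) * (2 * INR n + 1) * 16 ^ n)) S1 /\
     zeta 3 = 4 * PI ^ 2 / 35 * (3 / 2 - ln (PI / 2) + S1)) /\
  (exists S2 : R,
     is_series_from1
       (fun n : nat =>
          zeta (2 * INR n) /
            (INR n * (2 * INR n + 1) * (2 * INR n + 3) * 16 ^ n)) S2 /\
     zeta 3 = - (64 / (3 * PI)) * dirichlet_beta 4
              + 8 * PI ^ 2 / 9 * (4 / 3 - ln (PI / 2) + 3 * S2)) /\
  (exists S3 : R,
     is_series_from1
       (fun n : nat =>
          zeta (2 * INR n) /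
            ((2 * INR n + 1) * (2 * INR n + 3) * 16 ^ n)) S3 /\
     zeta 3 = - (64 / (3 * PI)) * dirichlet_beta 4
              + 16 * PI ^ 2 / 27 * (1 / 2 + 3 * Catalan / PI - 3 * S3)).
Proof.
  pose proof PI_RGT_0 as Hpi.
  pose proof zeta_log_series as HA.
  pose proof (zeta_moment_series 0) as H0. rewrite cot_moment_0 in H0.
  pose proof (zeta_moment_series 1) as H1. rewrite cot_moment_1 in H1.
  pose proof (zeta_moment_series 2) as H2. rewrite cot_moment_2 in H2.
  assert (Hside : forall n, (1 <= n)%nat -> 0 < INR n /\ 16 ^ n <> 0).
  { intros n Hn. split; [apply lt_0_INR; lia | apply pow_nonzero; lra]. }
  repeat split.
  - eexists. split.
    (* 1 / (n (n+1) (2n+1)) = 1/n + 2/(2n+2) - 4/(2n+1) *)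
    + apply (is_series_from1_combination _ _ _ _ _ _ _ 1 2 (-4) HA H1 H0).
      intros n Hn. destruct (Hside n Hn). simpl INR. field. lra.
    + simpl. field. lra.
  - eexists. split.
    (* 1 / (n (2n+1) (2n+3)) = 1/(3n) - 1/(2n+1) + 1/(3 (2n+3)) *)
    + apply (is_series_from1_combination _ _ _ _ _ _ _ (1 / 3) (1 / 3) (-1) HA H2 H0).
      intros n Hn. destruct (Hside n Hn). simpl INR. field. lra.
    + simpl. field. lra.
  - eexists. split.
    (* 1 / ((2n+1) (2n+3)) = (1/(2n+1) - 1/(2n+3)) / 2 *)
    + apply (is_series_from1_combination _ _ _ _ _ _ _ (1 / 2) (- 1 / 2) 0 H0 H2 HA).
      intros n Hn. destruct (Hside n Hn). simpl INR. field. lra.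
    + simpl. field. lra.
Qed.
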